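(* Let $\rho$ be a parabolic isometry of three-dimensional Minkowski space $\mathbb{E}$ with fixed points. Choose the origin in the fixed point set of $\rho$ (so $\rho$ is identified with its linear part), let $\mathsf{x}^o(\rho)$ be a future-pointing lightlike vector fixed by the linear part of $\rho$, let $\mathsf{x}^o(\rho)^\perp$ be the plane of vectors $\mathbb{B}$-orthogonal to $\mathsf{x}^o(\rho)$, and let $\mathbb{E}_\rho=\mathbb{E}\setminus\mathbb{R}\,\mathsf{x}^o(\rho)$. Then $$\mathcal{F}(\langle\rho\rangle)=\mathbb{E}_\rho\qquad\text{and}\qquad\mathcal{T}(\langle\rho\rangle)=\emptyset,$$ that is, the CTC region of $\mathbb{E}_\rho/\langle\rho\rangle$ is empty. Moreover, the spacelike region $\mathcal{S}(\rho)$ has two connected components, separated in $\mathbb{E}_\rho$ by the lightlike region $\mathcal{L}(\rho)\cap\mathbb{E}_\rho=\mathsf{x}^o(\rho)^\perp\setminus\mathbb{R}\,\mathsf{x}^o(\rho)$.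
   Context: $\mathbb{E}$ is the affine space modeled on $\mathbb{R}^{2,1}=\mathbb{R}^3$ with the form $\mathbb{B}((x,y,z),(u,v,w))=xu+yv-zw$; once an origin is chosen, points are identified with vectors. A vector $v$ is timelike if $\mathbb{B}(v,v)<0$, lightlike if $\mathbb{B}(v,v)=0$, spacelike if $\mathbb{B}(v,v)>0$. A timelike or nonzero lightlike vector is future pointing if its third coordinate is positive. $\mathrm{Isom}(\mathbb{E})$ is the group of affine isometries $\gamma(p)=g(p)+v$, with linear part $g\in \mathrm{O}(2,1)$ and translational part $v\in\mathbb{R}^{2,1}$; only isometries preserving orientation and time-orientation (linear part in the identity component of $\mathrm{SO}(2,1)$) are considered. Such an isometry is parabolic if $g\ne \mathrm{id}$ and $\mathrm{tr}(g)=3$. In that case $g$ has a unique eigendirection, which is lightlike and fixed by $g$; if $\rho$ is parabolic with a fixed point, its fixed point set is a line parallel to this direction. For an isometry $\rho$: $\mathcal{S}(\rho)=\{p\in\mathbb{E}:\mathbb{B}(\rho(p)-p,\rho(p)-p)>0\}$ and $\mathcal{L}(\rho)=\{p\in\mathbb{E}:\mathbb{B}(\rho(p)-p,\rho(p)-p)=0\}$. Closed timelike curves: if $\Gamma$ acts on an open set $X\subset\mathbb{E}$ so that every point of $X$ has a neighborhood $U$ with $\eta U\cap U=\emptyset$ for all $\eta\in\Gamma\setminus\{1\}$, then $X/\Gamma$ inherits a flat Lorentz structure; a timelike curve in $X/\Gamma$ is a $C^1$ path $c:[0,1]\to X/\Gamma$ all of whose tangent vectors are timelike, and it is closed if $c(0)=c(1)$.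 The CTC region of $X/\Gamma$ is the set of points lying on some closed timelike curve. $\mathcal{T}(\Gamma)$ is the set of $p\in X$ whose image $[p]$ lies in the CTC region of $X/\Gamma$, and $\mathcal{F}(\Gamma)=X\setminus\mathcal{T}(\Gamma)$. Here $\Gamma=\langle\rho\rangle$ and $X=\mathbb{E}_\rho$. *)

(* Defs.v *)
From HB Require Import structures.
From mathcomp Require Import all_boot all_order all_algebra.
From mathcomp Require Import all_classical all_reals all_analysis.

Set Implicit Arguments.
Unset Strict Implicit.
Unset Printing Implicit Defensive.

Import Order.TTheory GRing.Theory Num.Theory.
Import numFieldNormedType.Exports.

Local Open Scope classical_set_scope.
Local Open Scope ring_scope.

(* The affine space E is identified with 'cV[R]_3 by an arbitrary choice of
   origin, so points and vectors share this type. *)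

Section Minkowski.
Variable R : realType.
Implicit Types (u w : 'cV[R]_3) (g : 'M[R]_3).

Definition lorentz u w : R := u 0 0 * w 0 0 + u 1 0 * w 1 0 - u 2 0 * w 2 0.

Definition timelike u : Prop := lorentz u u < 0.
Definition lightlike u : Prop := lorentz u u = 0.
Definition spacelike u : Prop := 0 < lorentz u u.

Definition future_pointing u : Prop :=
  (timelike u \/ (lightlike u /\ u <> 0)) /\ 0 < u 2 0.

Definition O21 : set 'M[R]_3 :=
  [set g | forall u w, lorentz (g *m u) (g *m w) = lorentz u w].
Definition SO21 : set 'M[R]_3 := O21 `&` [set g | \det g = 1].
Definition SO21_id : set 'M[R]_3 := connected_component SO21 1%:M.

Definition affine g (v p : 'cV[R]_3) : 'cV[R]_3 := g *m p + v.

(* Linear parts of the parabolic isometries; the translational part plays no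
   role in the definition. *)
Definition parabolic g : Prop := [/\ SO21_id g, g <> 1%:M & \tr g = 3].

Definition spacelike_region (rho : 'cV[R]_3 -> 'cV[R]_3) : set 'cV[R]_3 :=
  [set p | spacelike (rho p - p)].
Definition lightlike_region (rho : 'cV[R]_3 -> 'cV[R]_3) : set 'cV[R]_3 :=
  [set p | lightlike (rho p - p)].

Definition line (o x : 'cV[R]_3) : set 'cV[R]_3 :=
  [set p | exists a : R, p = o + a *: x].
Definition orth_plane (o x : 'cV[R]_3) : set 'cV[R]_3 :=
  [set p | lorentz (p - o) x = 0].

End Minkowski.

(* The iterates of rho together with their two-sided inverses. *)
Definition cyclic_group (T : Type) (rho : T -> T) : set (T -> T) :=
  [set eta | exists n : nat, eta = iter n rho \/
     (cancel (iter n rho) eta /\ cancel eta (iter n rho))].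

Section Quotient.
Variables (R : realType) (Gamma : set ('cV[R]_3 -> 'cV[R]_3)).
Variable X : set 'cV[R]_3.

(* Points of X / Gamma are orbits, seen as subsets of E. *)
Definition orbit_of (p : 'cV[R]_3) : set 'cV[R]_3 :=
  [set eta p | eta in Gamma].
Definition quotient : set (set 'cV[R]_3) := [set orbit_of p | p in X].

(* On such a U the projection X -> X / Gamma is injective, and its local inverse
   is a chart of the flat Lorentz structure of X / Gamma. *)
Definition chart_domain (U : set 'cV[R]_3) : Prop :=
  [/\ open U, U `<=` X &
      forall eta, Gamma eta -> eta <> id -> eta @` U `&` U = set0].

Definition has_lorentz_quotient : Prop :=
  [/\ open X, forall eta, Gamma eta -> eta @` X = X &
      forall p, X p -> exists2 U, chart_domain U & U p].

Definition C1_near (sigma : R -> 'cV[R]_3) (t : R) : Prop :=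
  \forall s \near t,
    derivable sigma s 1 /\ derive1 sigma @ s --> derive1 sigma s.

(* sigma is the expression of c in the chart given by U.  At the end points of
   [0, 1], sigma is a C^1 extension of this expression past the end point, whose
   derivative there is the one-sided derivative of the path. *)
Definition timelike_curve (c : R -> set 'cV[R]_3) : Prop :=
  forall t : R, 0 <= t <= 1 ->
  exists (U : set 'cV[R]_3) (sigma : R -> 'cV[R]_3),
    [/\ chart_domain U, C1_near sigma t &
        \forall s \near t, 0 <= s <= 1 ->
          [/\ U (sigma s), c s = orbit_of (sigma s) &
              timelike (derive1 sigma s)]].

Definition CTC_region : set (set 'cV[R]_3) :=
  [set q | quotient q /\ exists c : R -> set 'cV[R]_3,
     [/\ timelike_curve c, c 0 = c 1 &
         exists2 t : R, 0 <= t <= 1 & c t = q]].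

Definition T_region : set 'cV[R]_3 := [set p | X p /\ CTC_region (orbit_of p)].
Definition F_region : set 'cV[R]_3 := X `\` T_region.

End Quotient.

Definition components (T : topologicalType) (A : set T) : set (set T) :=
  [set connected_component A p | p in A].

Definition separates_in (T : topologicalType) (X L A B : set T) : Prop :=
  exists U V : set T,
    [/\ X `\` L = U `|` V, separated U V, A `<=` U & B `<=` V].

(* Main.v *)
(* Complete the fixed null vector x to a basis x, e, y with e a unit spacelike
   vector orthogonal to the null vectors x and y, and lorentz x y = 1.  An
   isometry fixing x and of trace 3 also acts trivially on x^perp / R x, so it is
   a null rotation exp (s N): with l = lorentz (p - o) x, m = lorentz (p - o) e,
   it preserves l, sends m to m - s l, and moves p by a vector of square norm
   (s l)^2.  Hence the lightlike region is the plane l = 0 and the spacelike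
   region consists of the two open half-spaces bounded by it.  Since l is
   invariant it descends to the quotient, where it is strictly monotone along
   timelike curves, because a timelike vector is never orthogonal to x. *)
Require Import Defs.
From mathcomp Require Import all_boot all_order all_algebra.
From mathcomp Require Import all_classical all_reals all_analysis.
From mathcomp Require Import ring lra zify.

Set Implicit Arguments.
Unset Strict Implicit.
Unset Printing Implicit Defensive.

Import Order.TTheory GRing.Theory Num.Theory.
Import numFieldNormedType.Exports.
Local Open Scope classical_set_scope.
Local Open Scope ring_scope.

(** * The Lorentz form, null vectors and null frames *)

Section Lorentz.
Context {R : realType}.
Implicit Types (p u w x e y : 'cV[R]_3) (g : 'M[R]_3) (s t : R).

Lemma lorentzC u w : lorentz u w = lorentz w u.
Proof. by rewrite /lorentz; ring. Qed.

Lemma lorentzDl u1 u2 w : lorentz (u1 + u2) w = lorentz u1 w + lorentz u2 w.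
Proof. by rewrite /lorentz !mxE; ring. Qed.

Lemma lorentzNl u w : lorentz (- u) w = - lorentz u w.
Proof. by rewrite /lorentz !mxE; ring. Qed.

Lemma lorentzZl t u w : lorentz (t *: u) w = t * lorentz u w.
Proof. by rewrite /lorentz !mxE; ring. Qed.

Lemma lorentzDr u w1 w2 : lorentz u (w1 + w2) = lorentz u w1 + lorentz u w2.
Proof. by rewrite !(lorentzC u) lorentzDl. Qed.

Lemma lorentzNr u w : lorentz u (- w) = - lorentz u w.
Proof. by rewrite !(lorentzC u) lorentzNl. Qed.

Lemma lorentzZr t u w : lorentz u (t *: w) = t * lorentz u w.
Proof. by rewrite !(lorentzC u) lorentzZl. Qed.

Definition lorentzE :=
  (lorentzDl, lorentzDr, lorentzNl, lorentzNr, lorentzZl, lorentzZr).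

Lemma lorentz_continuous w o : continuous (fun p => lorentz (p - o) w).
Proof.
have cD (f h : 'cV[R]_3 -> R) : continuous f -> continuous h ->
    continuous (fun p => f p + h p).
  by move=> cf ch p; apply: (@continuousD R R^o _ f h); [exact: cf | exact: ch].
have cM k i : continuous (fun p : 'cV[R]_3 => k * (p i 0 - o i 0)).
  move=> p; apply: (@continuousM R 'cV[R]_3 (fun=> k)); first exact: cst_continuous.
  apply: (@continuousB R R^o); last exact: cst_continuous.
  exact: coord_continuous.
have -> : (fun p => lorentz (p - o) w) =
    (fun p => w 0 0 * (p 0 0 - o 0 0) + w 1 0 * (p 1 0 - o 1 0)
              + - w 2 0 * (p 2 0 - o 2 0)).
  by apply/funext => p; rewrite /lorentz !mxE; ring.
by apply: (cD); [apply: (cD) |]; exact: cM.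
Qed.

Lemma open_halfspace k w o : open [set p | k < lorentz (p - o) w].
Proof.
apply: (@open_comp _ _ (fun p => lorentz (p - o) w) [set r | k < r]).
  by move=> p _; exact: lorentz_continuous.
exact: open_gt.
Qed.

(* Reversed Cauchy-Schwarz. *)
Lemma timelike_lightlike_neq0 u x :
  timelike u -> lightlike x -> x 2 0 != 0 -> lorentz u x != 0.
Proof.
rewrite /timelike /lightlike /lorentz => ut xl x2; apply/eqP => ux.
move: ut; set a := x 0 0 in xl ux *; set b := x 1 0 in xl ux *.
set c := x 2 0 in xl ux x2 *.
set p := u 0 0 in ux *; set q := u 1 0 in ux *; set r := u 2 0 in ux * => ut.
have c2 : 0 < c ^+ 2 by rewrite exprn_even_gt0.
have : 0 < c ^+ 2 * (r * r - (p * p + q * q)) by apply: mulr_gt0 => //; lra.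
(* Lagrange's identity for [(p, q)] and [(a, b)]. With [x] null and orthogonal to [u], only the
   nonpositive term [- (p * b - q * a) ^+ 2] survives. *)
have -> : c ^+ 2 * (r * r - (p * p + q * q)) =
  - (p * b - q * a) ^+ 2 + (r * c - (p * a + q * b)) * (r * c + p * a + q * b)
  + (a * a + b * b - c * c) * (p * p + q * q) by ring.
have -> : r * c - (p * a + q * b) = 0 by lra.
rewrite xl !mul0r !addr0 oppr_gt0 => h.
by have := sqr_ge0 (p * b - q * a); rewrite leNgt h.
Qed.

(** The form pairs [x] with [y] and [e] with itself, so the dual frame is [y, e, x]; hence the
    coefficients in [null_frame_decomp]. *)
Record null_frame x e y : Prop := NullFrame {
  null_frame_xx : lorentz x x = 0;
  null_frame_xe : lorentz x e = 0;
  null_frame_xy : lorentz x y = 1;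
  null_frame_ee : lorentz e e = 1;
  null_frame_ey : lorentz e y = 0;
  null_frame_yy : lorentz y y = 0;
  null_frame_decomp : forall p,
    p = lorentz p y *: x + lorentz p e *: e + lorentz p x *: y
}.

Lemma sum_ord3 (F : 'I_3 -> R) : \sum_(i < 3) F i = F 0 + F 1 + F 2.
Proof.
by rewrite !big_ord_recl big_ord0 addr0 addrA; congr (_ + F _ + F _); apply/val_inj.
Qed.

Lemma colP3 u w :
  u 0 0 = w 0 0 -> u 1 0 = w 1 0 -> u 2 0 = w 2 0 -> u = w.
Proof.
move=> h0 h1 h2; apply/colP => -[[|[|[|//]]] lt3].
- by rewrite (_ : Ordinal lt3 = 0) //; apply/val_inj.
- by rewrite (_ : Ordinal lt3 = 1) //; apply/val_inj.
- by rewrite (_ : Ordinal lt3 = 2) //; apply/val_inj.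
Qed.

Lemma null_frame_exists x :
  lightlike x -> x 2 0 != 0 -> exists e y, null_frame x e y.
Proof.
rewrite /lightlike /lorentz => xl c0.
(* [e] is the horizontal part of [x] after a quarter turn, of length 1 because [x] is null; [y] is
   [x] with its time coordinate reversed, scaled so that its product with [x] is 1. *)
pose e : 'cV[R]_3 := \col_i [:: - x 1 0 / x 2 0; x 0 0 / x 2 0; 0]`_i.
pose y : 'cV[R]_3 := (2 * x 2 0 ^+ 2)^-1 *: \col_i [:: x 0 0; x 1 0; - x 2 0]`_i.
have a2 : x 0 0 ^+ 2 = x 2 0 ^+ 2 - x 1 0 ^+ 2.
  by apply/eqP; rewrite -subr_eq0 -xl; apply/eqP; ring.
exists e, y; split; rewrite /e /y /lorentz ?mxE /=.
- exact: xl.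
- by field.
- by field: a2.
- by field: a2.
- by field.
- by field: a2.
- move=> p; apply: colP3; rewrite !mxE /=; field: a2 => //.
Qed.

(** Sums the diagonal coefficients of [g] in the frame, read off by pairing with the dual frame
    [y, e, x]. *)
Lemma mxtrace_null_frame x e y g : null_frame x e y ->
  \tr g = lorentz (g *m x) y + lorentz (g *m e) e + lorentz (g *m y) x.
Proof.
move=> [_ _ _ _ _ _ decomp].
pose d i : 'cV[R]_3 := delta_mx i 0.
have E i : g i i = lorentz (d i) y * (g *m x) i 0
    + lorentz (d i) e * (g *m e) i 0 + lorentz (d i) x * (g *m y) i 0.
  transitivity ((g *m d i) i 0); first by rewrite -colE mxE.
  by rewrite [in LHS](decomp (d i)) !mulmxDr -!scalemxAr !mxE.
rewrite /mxtrace sum_ord3 !E /lorentz ![d _ _ _]mxE /=.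
ring.
Qed.
End Lorentz.

(** * Null rotations as the parabolic isometries with a fixed point *)

Section NullRotation.
Context {R : realType}.
Implicit Types (p u w x e y o : 'cV[R]_3) (g : 'M[R]_3) (s t : R).

(* The exponential of [t N], where [N q = lorentz q e *: x - lorentz q x *: e] is
   nilpotent of order 3, acting about the origin [o]. *)
Definition null_rotation x e o t p : 'cV[R]_3 :=
  p + (t * lorentz (p - o) e - t ^+ 2 / 2 * lorentz (p - o) x) *: x
    - (t * lorentz (p - o) x) *: e.

Context {x e y : 'cV[R]_3} (fr : null_frame x e y).

Let frameE := (null_frame_xx fr, null_frame_xe fr, null_frame_xy fr,
  null_frame_ee fr, null_frame_ey fr, null_frame_yy fr, lorentzC e x,
  lorentzC y x, lorentzC y e).

Lemma lorentz_null_rotation_x o t p :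
  lorentz (null_rotation x e o t p - o) x = lorentz (p - o) x.
Proof. by rewrite /null_rotation !lorentzE !frameE; ring. Qed.

Lemma lorentz_null_rotation_e o t p :
  lorentz (null_rotation x e o t p - o) e
  = lorentz (p - o) e - t * lorentz (p - o) x.
Proof. by rewrite /null_rotation !lorentzE !frameE; ring. Qed.

Lemma lorentz_null_rotation_y o t p :
  lorentz (null_rotation x e o t p - o) y
  = lorentz (p - o) y + t * lorentz (p - o) e - t ^+ 2 / 2 * lorentz (p - o) x.
Proof. by rewrite /null_rotation !lorentzE !frameE; ring. Qed.

Lemma null_rotation0 o : null_rotation x e o 0 = id.
Proof.
apply/funext => p; rewrite /null_rotation !mul0r expr0n !mul0r subrr !scale0r.
by rewrite addr0 subr0.
Qed.

Lemma null_rotationD o s t p :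
  null_rotation x e o s (null_rotation x e o t p) = null_rotation x e o (s + t) p.
Proof.
rewrite {1}/null_rotation lorentz_null_rotation_x lorentz_null_rotation_e.
by apply/matrixP => i j; rewrite /null_rotation !mxE; field.
Qed.

Lemma null_rotationK o t :
  cancel (null_rotation x e o t) (null_rotation x e o (- t)).
Proof. by move=> p; rewrite null_rotationD addNr null_rotation0. Qed.

Lemma null_rotationNK o t :
  cancel (null_rotation x e o (- t)) (null_rotation x e o t).
Proof. by move=> p; rewrite null_rotationD subrr null_rotation0. Qed.

Lemma iter_null_rotation o t n :
  iter n (null_rotation x e o t) = null_rotation x e o (n%:R * t).
Proof.
elim: n => [|n IHn]; first by rewrite mul0r null_rotation0.
by apply/funext => p; rewrite iterS IHn null_rotationD -[in RHS]natr1 mulrDl mul1r addrC.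
Qed.

Lemma cyclic_group_null_rotation o t eta :
  cyclic_group (null_rotation x e o t) eta ->
  exists k : int, eta = null_rotation x e o (k%:~R * t).
Proof.
move=> [n [->|[_ etaK]]]; first by exists n; rewrite iter_null_rotation.
exists (- n%:Z); apply/funext => p.
rewrite mulrNz mulNr -{2}[p]etaK iter_null_rotation.
by rewrite [RHS]null_rotationK.
Qed.

(** The displacement lies in the span of [x] and [e]; as [x] is null and orthogonal to [e], only the
    [e] coefficient contributes. *)
Lemma lorentz_null_rotationB o t p :
  lorentz (null_rotation x e o t p - p) (null_rotation x e o t p - p)
  = (t * lorentz (p - o) x) ^+ 2.
Proof.
have -> : null_rotation x e o t p - p =
  (t * lorentz (p - o) e - t ^+ 2 / 2 * lorentz (p - o) x) *: x
    - (t * lorentz (p - o) x) *: e.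
  by apply/matrixP => i j; rewrite /null_rotation !mxE; ring.
by rewrite !lorentzE !frameE; ring.
Qed.

Lemma lineP o p :
  line o x p <-> lorentz (p - o) x = 0 /\ lorentz (p - o) e = 0.
Proof.
split=> [[a ->]|[px pe]].
  by rewrite addrAC subrr add0r !lorentzE !frameE mulr0.
exists (lorentz (p - o) y).
rewrite -[LHS](subrK o) addrC [p - o in LHS](null_frame_decomp fr).
by rewrite px pe !scale0r !addr0.
Qed.

(** In the frame, the trace forces the [e] coefficient of [g *m e] to be 1. Its [x] coefficient is
    the parameter [s], and then [g *m y] is determined by being null, orthogonal to [g *m e] and of
    product 1 with [x]. *)
Lemma O21_null_rotation g v o : O21 g -> g *m x = x -> \tr g = 3 ->
  affine g v o = o -> exists s, affine g v = null_rotation x e o s.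
Proof.
move=> Og gx trg fixo.
have gE u w : lorentz (g *m u) (g *m w) = lorentz u w by exact: Og.
have gEx u : lorentz (g *m u) x = lorentz u x by rewrite -{1}gx gE.
have gee : lorentz (g *m e) e = 1.
  move: trg; rewrite (mxtrace_null_frame g fr) gx gEx !frameE; lra.
pose s := lorentz (g *m e) y.
have ge : g *m e = s *: x + e.
  rewrite [LHS](null_frame_decomp fr) gee gEx !frameE scale0r addr0 scale1r.
  by [].
have gey : lorentz (g *m y) e = - s.
  have : lorentz (g *m y) (g *m e) = 0 by rewrite gE !frameE.
  by rewrite ge !lorentzE gEx !frameE; lra.
have gyx : lorentz (g *m y) x = 1 by rewrite gEx !frameE.
have gy : g *m y = - (s ^+ 2 / 2) *: x - s *: e + y.
  have gyE := null_frame_decomp fr (g *m y).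
  rewrite gyx gey scale1r scaleNr in gyE; rewrite {1}gyE; congr (_ *: _ - _ + _).
  have : lorentz (g *m y) (g *m y) = 0 by rewrite gE !frameE.
  by rewrite {1}gyE !lorentzE !(lorentzC _ (g *m y)) gyx gey; lra.
exists s; apply/funext => p.
have -> : affine g v p = g *m (p - o) + o.
  by rewrite -{2}fixo /affine mulmxBr addrA subrK.
rewrite /null_rotation; set q := p - o.
rewrite {1}[q](null_frame_decomp fr) !mulmxDr -!scalemxAr gx ge gy.
have -> : p = q + o by rewrite /q subrK.
rewrite {4}[q](null_frame_decomp fr).
by apply/matrixP => i j; rewrite !mxE; field.
Qed.
End NullRotation.

(** * Separated sets and connected components *)

Section Topology.
Context {T : topologicalType}.
Implicit Types A B : set T.

Lemma open_disjoint_separated A B :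
  open A -> open B -> A `&` B = set0 -> separated A B.
Proof.
have cl0 C D : open D -> C `&` D = set0 -> closure C `&` D = set0.
  move=> oD CD0; rewrite -subset0 => p [clC Dp].
  by have [q] := clC D (open_nbhs_nbhs (conj oD Dp)); rewrite CD0.
move=> oA oB AB0; split; first exact: cl0.
by rewrite setIC; apply: cl0 => //; rewrite setIC.
Qed.

(** A connected subset of a union of two separated sets lies in one of them, so neither connected
    piece can be enlarged. *)
Lemma componentsU_separated A B : A !=set0 -> B !=set0 ->
  connected A -> connected B -> separated A B ->
  components (A `|` B) = [set A; B].
Proof.
have half C D p : connected C -> separated C D -> C p ->
    connected_component (C `|` D) p = C.
  move=> cC sCD Cp; apply/seteqP; split; last first.
    by apply: connected_component_max => //; exact: subsetUl.
  have CDp : (C `|` D) p by left.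
  have [//|sub] := connected_subset sCD (@connected_component_sub _ _ p)
    (@component_connected _ _ p).
  have : (C `&` D) p by split=> //; apply/sub/connected_component_refl.
  by rewrite (separated_disjoint sCD).
move=> [a Aa] [b Bb] cA cB sAB; have sBA : separated B A by rewrite separatedC.
apply/seteqP; split=> [C [p [Ap|Bp] <-]|C [->|->]].
- by left; exact: half.
- by right; rewrite setUC; exact: half.
- by exists a; [left | exact: half].
- by exists b; [right | rewrite setUC; exact: half].
Qed.
End Topology.

(** * Connectedness of open half-spaces *)

Section Halfspaces.
Context {R : realType}.
Implicit Types (p q w x o : 'cV[R]_3).

Lemma connected_halfspace w o k : connected [set p | k < lorentz (p - o) w].
Proof.
set A := [set p | _].
have [->|/set0P[p Ap]] := eqVneq A set0; first exact: connected0.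
pose seg q t := p + t *: (q - p).
(* The half-space is star-shaped about [p]: it is the union of the segments from [p] to its
   points. *)
have -> : A = \bigcup_(q in A) [set seg q t | t in `[0, 1] : set R].
  apply/seteqP; split=> [q Aq|_ [q Aq [t t01 <-]]].
    exists q => //; exists 1 => /=; first by rewrite in_itv /= ler01 lexx.
    by rewrite /seg scale1r addrC subrK.
  move: t01; rewrite /= in_itv /= => /andP[t0 t1]; rewrite /A /= in Ap Aq *.
  have -> : seg q t - o = (1 - t) *: (p - o) + t *: (q - o).
    by apply/matrixP => i j; rewrite !mxE; ring.
  rewrite lorentzDl !lorentzZl.
  have [->|t_neq1] := eqVneq t 1; first by rewrite subrr mul0r add0r mul1r.
  have : 0 < (1 - t) * (lorentz (p - o) w - k).
    by rewrite mulr_gt0 ?subr_gt0 // lt_neqAle t_neq1.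
  have : 0 <= t * (lorentz (q - o) w - k) by rewrite mulr_ge0 ?subr_ge0 // ltW.
  lra.
apply: bigcup_connected.
  exists p => q Aq; exists 0 => /=; first by rewrite in_itv /= ler01 lexx.
  by rewrite /seg scale0r addr0.
move=> q Aq; apply: connected_continuous_connected; first exact: segment_connected.
apply: continuous_subspaceT => t.
apply: (@continuousD R 'cV[R]_3 R^o (fun=> p)); first exact: cst_continuous.
by apply: (@continuousZr_tmp R 'cV[R]_3 R^o id); exact: cvg_id.
Qed.
End Halfspaces.

(** * The height function and closed timelike curves *)

Section Quotients.
Context {R : realType}.
Implicit Types (p q w x e y o : 'cV[R]_3) (s t : R).

Lemma is_derive_lorentz (sigma : R -> 'cV[R]_3) w o t : derivable sigma t 1 ->
  is_derive t 1 (fun s => lorentz (sigma s - o) w)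
    (lorentz (derive1 sigma t) w).
Proof.
move=> dsigma; have dcoord i := (derivable_mxP sigma t 1).1 dsigma i 0.
have dsigmaE i : is_derive t 1 (fun s => sigma s i 0) (derive1 sigma t i 0).
  by rewrite derive1E derive_mx // mxE; exact/derivableP.
have -> : (fun s => lorentz (sigma s - o) w) =
    (fun s => w 0 0 * (sigma s 0 0 - o 0 0) + w 1 0 * (sigma s 1 0 - o 1 0)
              - w 2 0 * (sigma s 2 0 - o 2 0)).
  by apply/funext => s; rewrite /lorentz !mxE; ring.
apply: is_derive_eq.
by rewrite /lorentz /GRing.scale /=; ring.
Qed.

(* The height [p |-> lorentz (p - o) x] descends to the quotient, and by the
   reversed Cauchy-Schwarz inequality it has nonzero derivative along every
   timelike curve, so Rolle's theorem forbids such a curve to close up. *)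
Lemma CTC_region_eq0 (Gamma : set ('cV[R]_3 -> 'cV[R]_3)) X o x :
  lightlike x -> x 2 0 != 0 -> Gamma id ->
  (forall eta p, Gamma eta -> lorentz (eta p - o) x = lorentz (p - o) x) ->
  CTC_region Gamma X = set0.
Proof.
move=> xl x2 Gid Ginv; rewrite -subset0 => D [_ [c [tc c01 _]]] /=.
(* [h] evaluates the height at a chosen point of the orbit [c s]; invariance makes the choice
   immaterial, and the default 0 is never taken on [[0, 1]], where orbits are nonempty. *)
pose h s := lorentz (xget 0 (c s) - o) x.
have hE s q : c s = orbit_of Gamma q -> h s = lorentz (q - o) x.
  move=> csq; have csq' : c s q by rewrite csq; exists id.
  have [eta Geta etaq] : orbit_of Gamma q (xget 0 (c s)).
    by rewrite -csq; exact: xgetI csq'.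
  by rewrite /h -etaq Ginv.
(* Local lifts [f] agree with [h] only inside [[0, 1]]. This gives a derivative at interior points
   and one-sided continuity at the ends, just what Rolle's theorem requires. *)
have h_local t : 0 <= t <= 1 -> exists f df,
    [/\ is_derive t 1 f df, df != 0 & \forall s \near t, 0 <= s <= 1 -> f s = h s].
  move=> t01; have [U [sigma [_ C1 loc]]] := tc t t01.
  exists (fun s => lorentz (sigma s - o) x), (lorentz (derive1 sigma t) x); split.
  - by apply: is_derive_lorentz; have [] := nbhs_singleton C1.
  - by apply: timelike_lightlike_neq0 => //; have [] := nbhs_singleton loc t01.
  - by apply: filterS loc => s loc_s s01; have [_ cs _] := loc_s s01; rewrite (hE _ _ cs).
have h_deriv t : t \in `]0, 1[ -> exists2 df, is_derive t 1 h df & df != 0.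
  rewrite in_itv /= => /andP[t0 t1].
  have [|f [df [f_df df0 fh]]] := h_local t; first by rewrite !ltW.
  exists df => //; apply: near_eq_is_derive f_df.
  near=> s; apply: (near fh s) => //.
  by apply/andP; split; apply/ltW; near: s; [exact: lt_nbhsr | exact: lt_nbhsl].
have h_derivable t : t \in `]0, 1[ -> derivable h t 1.
  by move=> /h_deriv[df [? _] _].
have h_cts : {within `[0, 1], continuous h}.
  apply/subspace_continuousP => t; rewrite /= in_itv /= => t01.
  have [f [df [[f_df _] _ fh]]] := h_local t t01.
  rewrite /from_subspace -(nbhs_singleton fh t01).
  have f_cts : f s @[s --> t] --> f t.
    by move/derivable1_diffP/differentiable_continuous : f_df.
  apply: cvg_trans (@cvg_within_filter _ _ _ _ _ _ `[0, 1]%classic f_cts).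
  apply: near_eq_cvg.
  apply: filterS fh => s fhs s01; apply: fhs.
  by move: s01; rewrite /= in_itv.
have h01 : h 0 = h 1 by rewrite /h c01.
have [t /h_deriv[df [_ <-] df0] [_ h'0]] := Rolle ltr01 h_derivable h_cts h01.
by rewrite h'0 eqxx in df0.
Unshelve. all: by end_near. Qed.
End Quotients.

(** * Charts for the quotient of the complement of the fixed line *)

Section NullRotationQuotient.
Context {R : realType} {x e y : 'cV[R]_3} (fr : null_frame x e y).
Implicit Types (p q o : 'cV[R]_3) (s t : R).

Lemma line_null_rotation o t p :
  line o x (null_rotation x e o t p) <-> line o x p.
Proof.
rewrite !(lineP fr) (lorentz_null_rotation_x fr) (lorentz_null_rotation_e fr).
by split=> -[-> h]; split=> //; move: h; rewrite mulr0 subr0.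
Qed.

(** The line is where the products with [x] and [e] both vanish, so its complement is a union of
    four open half-spaces. *)
Lemma open_line_complement o : open (~` line o x).
Proof.
have -> : ~` line o x = \bigcup_(w in [set x; - x; e; - e])
    [set p | 0 < lorentz (p - o) w].
  apply/seteqP; split=> [p /(lineP fr)/not_andP[]/eqP|p [w /= wE pw] /(lineP fr)].
  - rewrite neq_lt => /orP[px|px]; last by exists x => //; do 3!left.
    by exists (- x); [do 2!left; right | rewrite /= lorentzNr oppr_gt0].
  - rewrite neq_lt => /orP[pe|pe]; last by exists e => //; left; right.
    by exists (- e); [right | rewrite /= lorentzNr oppr_gt0].
  - move=> [px pe]; move: wE pw => [[[]|]|] ->;
      by rewrite ?lorentzNr ?px ?pe ?oppr0 ltxx.
by apply: bigcup_open => w _; exact: open_halfspace.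
Qed.

(** A nontrivial group element has parameter [k%:~R * s] with [k] a nonzero integer, hence of
    absolute value at least that of [s], too large to return a point of [U] to [U]. *)
Lemma chart_domain_null_rotation o s U : open U -> U `<=` ~` line o x ->
  (forall t p, U p -> U (null_rotation x e o t p) -> `|t| < `|s|) ->
  chart_domain (cyclic_group (null_rotation x e o s)) (~` line o x) U.
Proof.
move=> oU UX Us; split=> // eta /(cyclic_group_null_rotation fr)[k ->] k_neq_id.
rewrite -subset0 => _ [[p Up <-] /(Us _ _ Up)].
rewrite normrM ltNge ler_peMl // -intr_norm ler1z.
have : k != 0.
  by apply/eqP => k0; apply: k_neq_id; rewrite k0 mul0r null_rotation0.
by rewrite -absz_gt0; lia.
Qed.

(* A null rotation by [t] translates [lorentz (p - o) e / lorentz (p - o) x] by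
   [- t]; [U] is the region where this ratio is within [`|s| / 2] of its value at
   [p], written as an intersection of half-spaces. *)
Lemma chart_off_plane o s p : s != 0 -> lorentz (p - o) x != 0 ->
  exists2 U, chart_domain (cyclic_group (null_rotation x e o s)) (~` line o x) U
           & U p.
Proof.
(* The sign in [a] replaces the absolute value of the height by a linear function:
   [a * lorentz (q - o) x] is at most [|s| / 2] times that absolute value, with equality at
   [q = p]. *)
move=> s0 px; pose a : R := `|s| / 2 * Num.sg (lorentz (p - o) x).
pose b := lorentz (p - o) e / lorentz (p - o) x.
have sl q : 0 < lorentz (q - o) (a *: x + (e - b *: x)) ->
    0 < lorentz (q - o) (a *: x - (e - b *: x)) ->
    `|lorentz (q - o) e - b * lorentz (q - o) x| < `|s| / 2 * `|lorentz (q - o) x|.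
  rewrite !(lorentzDr, lorentzNr, lorentzZr) => h1 h2.
  apply: (@lt_le_trans _ _ (a * lorentz (q - o) x)).
    by rewrite ltr_norml; apply/andP; split; lra.
  rewrite /a -[_ * Num.sg _ * _]mulrA; apply: ler_wpM2l; first by rewrite divr_ge0.
  rewrite (le_trans (ler_norm _)) //.
  by rewrite normrM normr_sg px mul1r.
exists ([set q | 0 < lorentz (q - o) (a *: x + (e - b *: x))] `&`
        [set q | 0 < lorentz (q - o) (a *: x - (e - b *: x))]).
  apply: chart_domain_null_rotation.
  - by apply: openI; exact: open_halfspace.
  - move=> q [/= h1 h2] /(lineP fr)[qx qe]; have := sl q h1 h2.
    by rewrite qx qe !mulr0 subr0 normr0 mulr0 ltxx.
  - move=> t q [/= q1 q2] [/= r1 r2].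
    have := sl _ q1 q2; have := sl _ r1 r2.
    rewrite (lorentz_null_rotation_x fr) (lorentz_null_rotation_e fr).
    move: (lorentz (q - o) x) (lorentz (q - o) e) => l m h1 h2.
    have : `|t * l| < `|s| * `|l|.
      have -> : t * l = (m - b * l) - (m - t * l - b * l) by ring.
      by rewrite (le_lt_trans (ler_normB _ _)) //; lra.
    rewrite normrM; have [->|l0] := eqVneq l 0; first by rewrite normr0 !mulr0 ltxx.
    by rewrite ltr_pM2r // normr_gt0.
have ax : 0 < a * lorentz (p - o) x.
  by rewrite /a -[_ * Num.sg _ * _]mulrA -normrEsg mulr_gt0 ?divr_gt0 ?normr_gt0.
have bx : b * lorentz (p - o) x = lorentz (p - o) e by rewrite divfK.
by split; rewrite /= !(lorentzDr, lorentzNr, lorentzZr) bx subrr ?oppr0 addr0.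
Qed.

(* A null rotation by [t] changes [lorentz (p - o) y] by [t] times the mean of
   the values of [lorentz (p - o) e] before and after. *)
Lemma chart_on_plane o s p : s != 0 -> lorentz (p - o) e != 0 ->
  exists2 U, chart_domain (cyclic_group (null_rotation x e o s)) (~` line o x) U
           & U p.
Proof.
move=> s0; set m0 := lorentz (p - o) e => m0_neq0.
set n0 := lorentz (p - o) y.
have m0_gt0 : 0 < `|m0| by rewrite normr_gt0.
have s_gt0 : 0 < `|s| by rewrite normr_gt0.
have d_gt0 : 0 < `|s| * `|m0| / 4 by rewrite divr_gt0 ?mulr_gt0.
pose H w c d := [set q | c - d < lorentz (q - o) w] `&`
  [set q | - c - d < lorentz (q - o) (- w)].
have HE w c d q : H w c d q -> `|lorentz (q - o) w - c| < d.
  move=> [/= h1]; rewrite lorentzNr ltr_norml => h2.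
  by apply/andP; split; lra.
(* Before and after a return to this set the [e] products sum to more than [|m0|] in absolute value,
   while the [y] product changes by less than [|s| * |m0| / 2]. Half the sum times [t] is that
   change, so [|t| < |s|]. *)
exists (H e m0 (`|m0| / 2) `&` H y n0 (`|s| * `|m0| / 4)).
  apply: chart_domain_null_rotation.
  - by apply: openI; apply: openI; exact: open_halfspace.
  - move=> q [/HE qm _] /(lineP fr)[_ qe]; move: qm.
    by rewrite qe sub0r normrN; lra.
  - move=> t q [/HE qm /HE qn] [/HE rm /HE rn].
    move: qm qn rm rn.
    rewrite (lorentz_null_rotation_e fr) (lorentz_null_rotation_y fr).
    move: (lorentz (q - o) x) (lorentz (q - o) e) (lorentz (q - o) y) => l m n.
    move=> qm qn rm rn.
    have mean : `|m0| < `|m + (m - t * l)|.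
      have : `|m0 + m0| <= `|m + (m - t * l)| + `|m - m0| + `|m - t * l - m0|.
        have -> : m0 + m0 = m + (m - t * l) - (m - m0) - (m - t * l - m0) by ring.
        rewrite (le_trans (ler_normB _ _)) // lerD2r.
        exact: ler_normB.
      by rewrite -mulr2n normrMn mulr2n; lra.
    have : `|t| * `|m + (m - t * l)| < `|s| * `|m0|.
      rewrite -normrM.
      have -> : t * (m + (m - t * l)) =
          2 * ((n + t * m - t ^+ 2 / 2 * l - n0) - (n - n0)) by field.
      rewrite normrM (@ger0_norm _ 2) //.
      have := ler_normB (n + t * m - t ^+ 2 / 2 * l - n0) (n - n0).
      lra.
    move=> h; rewrite -(ltr_pM2r m0_gt0); apply: le_lt_trans h.
    by rewrite ler_wpM2l // ltW.
by split; split; rewrite /= ?lorentzNr -/m0 -/n0; lra.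
Qed.

(** Off the fixed line the products with [x] and [e] do not both vanish, so one of the two chart
    constructions applies. *)
Lemma has_lorentz_quotient_null_rotation o s : s != 0 ->
  has_lorentz_quotient (cyclic_group (null_rotation x e o s)) (~` line o x).
Proof.
move=> s0; split=> [|eta /(cyclic_group_null_rotation fr)[k ->]|p px].
- exact: open_line_complement.
- set t := k%:~R * s; apply/seteqP; split=> [_ [p px <-]|p px].
    by move=> /line_null_rotation.
  exists (null_rotation x e o (- t) p); first by move=> /line_null_rotation.
  exact: (null_rotationNK fr).
- have [px0|] := eqVneq (lorentz (p - o) x) 0; last exact: chart_off_plane.
  apply: chart_on_plane => //; apply/eqP => pe0; apply: px.
  by apply/(lineP fr).
Qed.
End NullRotationQuotient.

(** * Causal structure and spacelike region of a parabolic isometry *)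

Theorem proposition3p1 (R : realType) (g : 'M[R]_3) (v o x0 : 'cV[R]_3)
    (g_parabolic : parabolic g) (o_fixed : affine g v o = o)
    (x0_lightlike : lightlike x0) (x0_future : future_pointing x0)
    (x0_fixed : g *m x0 = x0) :
  let rho := affine g v in
  let Gamma := cyclic_group rho in
  let E_rho := ~` line o x0 in
  [/\ has_lorentz_quotient Gamma E_rho,
      F_region Gamma E_rho = E_rho,
      T_region Gamma E_rho = set0 &
      CTC_region Gamma E_rho = set0]
  /\
  [/\ lightlike_region rho `&` E_rho = orth_plane o x0 `\` line o x0 &
      exists C1 C2 : set 'cV[R]_3,
        [/\ C1 <> C2,
            components (spacelike_region rho) = [set C1; C2] &
            separates_in E_rho (lightlike_region rho `&` E_rho) C1 C2]].
Proof.
move=> rho Gamma E_rho.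
have x2 : x0 2 0 != 0 by case: x0_future => _ /lt0r_neq0.
have [e [y fr]] := null_frame_exists x0_lightlike x2.
have [SOg g_neq1 trg] := g_parabolic.
have [s rhoE] : exists s, rho = null_rotation x0 e o s.
  apply: (O21_null_rotation fr) => //.
  by have [] := connected_component_sub SOg.
have s0 : s != 0.
  apply/eqP => s0; apply: g_neq1.
  have rho_id : rho = id by rewrite rhoE s0 null_rotation0.
  have gE (u : 'cV_3) : g *m u = u.
    have : rho (u + o) - rho o = u by rewrite rho_id addrK.
    by rewrite /rho /affine mulmxDr opprD addrACA subrr addr0 addrK.
  apply/matrixP => i j; have /colP/(_ i) := gE (delta_mx j 0).
  by rewrite -colE !mxE eqxx andbT.
have Gamma_id : Gamma id by exists 0%N; left.
have CTC0 : CTC_region Gamma E_rho = set0.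
  apply: (@CTC_region_eq0 R Gamma E_rho o x0 x0_lightlike x2 Gamma_id) => eta p.
  rewrite /Gamma rhoE => /(cyclic_group_null_rotation fr)[k ->].
  exact: (lorentz_null_rotation_x fr).
have T0 : T_region Gamma E_rho = set0.
  by rewrite /T_region CTC0 -subset0 => p [].
have nsq p : lorentz (rho p - p) (rho p - p) = (s * lorentz (p - o) x0) ^+ 2.
  by rewrite rhoE (lorentz_null_rotationB fr).
have lightE : lightlike_region rho = orth_plane o x0.
  apply/seteqP; split=> p; rewrite /lightlike_region /lightlike /= nsq.
    by move=> /eqP; rewrite sqrf_eq0 mulf_eq0 (negPf s0) => /eqP.
  by move=> ->; rewrite mulr0 expr0n.
split; first split=> //.
- by rewrite /Gamma rhoE; exact: (has_lorentz_quotient_null_rotation fr).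
- by rewrite /F_region T0 setD0.
rewrite lightE -setDE; split=> //.
pose H (w : 'cV[R]_3) := [set p | 0 < lorentz (p - o) w].
(* Since [y] has product 1 with [x0], the points [y + o] and [- y + o] lie on opposite sides of the
   plane. *)
have H_y : H x0 (y + o).
  by rewrite /H /= addrK lorentzC (null_frame_xy fr).
have H_Ny : H (- x0) (- y + o).
  by rewrite /H /= addrK !lorentzE opprK lorentzC (null_frame_xy fr).
have disj : H x0 `&` H (- x0) = set0.
  by rewrite -subset0 => p []; rewrite /H /= lorentzNr; lra.
have sep : separated (H x0) (H (- x0)).
  by apply: open_disjoint_separated => //; exact: open_halfspace.
have HUE p : (H x0 `|` H (- x0)) p <-> lorentz (p - o) x0 != 0.
  rewrite /H /= lorentzNr oppr_gt0 neq_lt.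
  by split=> [[]->|/orP[]->]; rewrite ?orbT //; [right | left].
exists (H x0), (H (- x0)); split.
- by move=> HE; move: disj; rewrite -HE setIid => H0; rewrite H0 in H_y.
- rewrite -componentsU_separated //; [|by exists (y + o)|by exists (- y + o)| |];
    try exact: connected_halfspace.
  congr components; apply/seteqP; split=> p.
    rewrite /spacelike_region /spacelike /= nsq => h; apply/HUE.
    by apply/eqP => p0; rewrite p0 mulr0 expr0n ltxx in h.
  move=> /HUE p0; rewrite /spacelike_region /spacelike /= nsq.
  by rewrite exprn_even_gt0 //= mulf_neq0.
(* The fixed line lies in the plane, so removing the plane from [E_rho] leaves exactly the two
   half-spaces. *)
- exists (H x0), (H (- x0)); split=> //.
  apply/seteqP; split=> p.
    by move=> [Ep nLp]; apply/HUE/eqP => p0; apply: nLp.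
  move=> /HUE p0; split; first by move=> /(lineP fr)[/eqP]; rewrite (negPf p0).
  by move=> [/eqP]; rewrite (negPf p0).
Qed.
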